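(* Let $(E=E_{-n}\oplus\cdots\oplus E_{-1},\ \mu=l_1+\cdots+l_{n+1})$ be a symmetric Lie $n$-algebra. Let $N_1,\dots,N_r$ be a family of symmetric vector valued $k_1$-,$\dots$,$k_r$-forms, respectively, of degree zero on $E$, with $\frac{n+3}{2}\le k_1\le\cdots\le k_r\le n+1$. Let $S$ be the Euler map of $E$. Then $S+\sum_{i=1}^rN_i$ is a Nijenhuis vector valued form with respect to $\mu$, with square $S+2\sum_{i=1}^rN_i$. The deformed Lie $n$-algebra structure is $$\Big[S+\sum_{i=1}^rN_i,\mu\Big]_{_{RN}}=\mu+\sum_{i=1}^r\ \sum_{m=1}^{n-k_i+2}[N_i,l_m]_{_{RN}}.$$
   Context: Let $E=\oplus_{i\in\mathbb Z}E_i$ be a graded vector space over $\mathbb R$ or $\mathbb C$; $|X|$ is the degree of homogeneous $X$. A symmetric vector valued $k$-form is a graded symmetric $k$-linear map $K:E^{k}\to E$ (exchanging adjacent arguments $X,Y$ gives the sign $(-1)^{|X||Y|}$). It has degree $\bar K$ if $|K(X_1,\dots,X_k)|=|X_1|+\dots+|X_k|+\bar K$. For a $k$-form $K$ and $l$-form $L$, $$\iota_KL(X_1,\dots,X_{k+l-1})=\sum_{\sigma\in Sh(k,l-1)}\epsilon(\sigma)L(K(X_{\sigma(1)},\dots,X_{\sigma(k)}),X_{\sigma(k+1)},\dots,X_{\sigma(k+l-1)}),$$ with $Sh(k,l-1)$ the $(k,l-1)$-unshuffles and $\epsilon(\sigma)$ the Koszul sign. The Richardson–Nijenhuis bracket is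 $[K,L]_{_{RN}}=\iota_KL-(-1)^{\bar K\bar L}\iota_LK$, extended bilinearly to formal sums of forms. A symmetric $L_\infty$-structure is $\mu=\sum_{i\ge1}l_i$ with $l_i$ a symmetric vector valued $i$-form of degree $+1$ and $\sum_{i+j=m+1}\iota_{l_i}l_j=0$ for all $m\ge1$ (equivalently $[\mu,\mu]_{_{RN}}=0$). A symmetric Lie $n$-algebra is an $L_\infty$-algebra whose underlying graded vector space is concentrated in degrees $-n,\dots,-1$ (so only $l_1,\dots,l_{n+1}$ can be non-zero). For $\mu$ of degree $1$, a symmetric vector valued form $\mathcal N$ of degree $0$ is Nijenhuis with respect to $\mu$ with square $\mathcal K$ if $\mathcal K$ has degree $0$, $[\mathcal N,[\mathcal N,\mu]_{_{RN}}]_{_{RN}}=[\mathcal K,\mu]_{_{RN}}$ and $[\mathcal N,\mathcal K]_{_{RN}}=0$. Euler map: $S(X)=-|X|X$ for homogeneous $X$. *)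

(* Defs.v *)
From HB Require Import structures.
From mathcomp Require Import all_boot all_order all_fingroup all_algebra.
From mathcomp Require Import all_classical.

Set Implicit Arguments.
Unset Strict Implicit.
Unset Printing Implicit Defensive.

Import Order.TTheory GRing.Theory Num.Theory.

Local Open Scope classical_set_scope.
Local Open Scope ring_scope.

(* A graded vector space E = \oplus_(i : int) E_i, possibly infinite
   dimensional: [gpart i] is the projection of E onto its summand E_i, and every
   vector is the sum of its finitely many nonzero homogeneous parts. *)
HB.mixin Record Lmodule_isGraded (K : numFieldType) E of GRing.Lmodule K E := {
  gpart : int -> E -> E;
  gpart_linear : forall i, linear (gpart i);
  gpart_gpart : forall i j x,
    gpart i (gpart j x) = if i == j then gpart j x else 0;
  gpart_finite : forall x, finite_set [set i | gpart i x != 0];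
  gpart_sum : forall x, \sum_(i \in [set: int]) gpart i x = x
}.

#[short(type="gradedLmodType")]
HB.structure Definition GradedLmodule (K : numFieldType) :=
  { E of Lmodule_isGraded K E & GRing.Lmodule K E }.

(* A formal sum F = \sum_k F_k of maps F_k : E^k -> E is encoded as one function
   on lists, F_k being its restriction to the lists of length k. In particular
   a single k-ary map is a function that vanishes on lists of any other length,
   and sums of forms are the pointwise sums of functions. *)
Notation vform E := (seq E -> E).

Section VectorValuedForms.
Variables (K : numFieldType) (E : gradedLmodType K).
Implicit Types (F G N Q mu : vform E) (s : seq E) (x y : E).

(* The zero vector is homogeneous of every degree. *)
Definition homog (i : int) x : bool := gpart i x == x.

Definition vcomp (k : nat) F : vform E :=
  fun s => if size s == k then F s else 0.

Definition multilinear_form F : Prop :=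
  forall s1 s2 (a : K) x y,
    F (s1 ++ (a *: x + y) :: s2) = a *: F (s1 ++ x :: s2) + F (s1 ++ y :: s2).

Definition graded_symmetric F : Prop :=
  forall s1 s2 (i j : int) x y, homog i x -> homog j y ->
    F (s1 ++ x :: y :: s2) = (-1 : K) ^ (i * j) *: F (s1 ++ y :: x :: s2).

Definition has_degree (a : int) F : Prop :=
  forall (d : seq int) s, all2 homog d s ->
    homog (\sum_(i <- d) i + a) (F s).

Definition symmetric_form (a : int) F : Prop :=
  [/\ multilinear_form F, graded_symmetric F & has_degree a F].

Definition symmetric_kform (k : nat) (a : int) F : Prop :=
  symmetric_form a F /\ forall s, size s != k -> F s = 0.

(* Sh(k, m - k): increasing on the first k and on the last m - k indices. *)
Definition unshuffles (k m : nat) : {set 'S_m} :=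
  [set sigma : 'S_m | [forall i : 'I_m, forall j : 'I_m,
     (i < j)%N && ((j < k)%N || (k <= i)%N) ==> (sigma i < sigma j)%N]].

(* The sign relating X_(sigma 1) ... X_(sigma m) to X_1 ... X_m when X_i has
   degree d i: one factor for each pair of arguments that sigma inverts. *)
Definition koszul (m : nat) (d : 'I_m -> int) (sigma : 'S_m) : K :=
  \prod_(p : 'I_m * 'I_m | (p.1 < p.2)%N && (sigma p.2 < sigma p.1)%N)
    (-1 : K) ^ (d (sigma p.1) * d (sigma p.2)).

Definition homog_insertion (k m : nat) F G (d : 'I_m -> int) (X : 'I_m -> E) : E :=
  \sum_(sigma in unshuffles k m)
    koszul d sigma *:
      (let Y := [seq X (sigma i) | i <- enum 'I_m] in
       G (F (take k Y) :: drop k Y)).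

(* [homog_insertion] is meaningful on homogeneous arguments X_i of degree d i;
   it is extended multilinearly by splitting each argument of s into its
   homogeneous parts. For multilinear F and G only finitely many degree vectors
   d contribute to the sum. The map [insertion k F G], on lists of length m,
   inserts F_k into G_l with k + (l - 1) = m. *)
Definition insertion (k : nat) F G : vform E :=
  fun s => \sum_(d \in [set: {ffun 'I_(size s) -> int}])
    homog_insertion k F G d (fun i => gpart (d i) (nth 0 s i)).

(* iota_F G, bilinear in the formal sums F and G: the component of arity m is
   the sum of iota_(F_k) G_l over all k and all l >= 1 with k + l - 1 = m. *)
Definition iota_form F G : vform E :=
  fun s => \sum_(k < (size s).+1) insertion k F G s.

(* The Richardson-Nijenhuis bracket of F and G of degrees a and b. *)
Definition rn_bracket (a b : int) F G : vform E :=
  iota_form F G - (-1 : K) ^ (a * b) *: iota_form G F.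

Definition Linfty_structure mu : Prop :=
  [/\ symmetric_form 1 mu, mu [::] = 0 &
      forall m : nat, (1 <= m)%N ->
        \sum_(1 <= i < m.+1)
          iota_form (vcomp i mu) (vcomp (m.+1 - i)%N mu) = 0].

Definition concentrated (n : nat) : Prop :=
  forall (i : int) x, ~~ ((- (n%:Z) <= i) && (i <= -1)) -> gpart i x = 0.

Definition Lie_n_algebra (n : nat) mu : Prop :=
  concentrated n /\ Linfty_structure mu.

Definition nijenhuis_form mu N Q : Prop :=
  [/\ symmetric_form 0 N, symmetric_form 0 Q,
      rn_bracket 0 1 N (rn_bracket 0 1 N mu) = rn_bracket 0 1 Q mu &
      rn_bracket 0 0 N Q = 0].

Definition euler : vform E :=
  fun s => if s is [:: x]
           then \sum_(i \in [set: int]) (- i)%:~R *: gpart i x else 0.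

End VectorValuedForms.

Arguments euler {K} E.

(* Main.v *)
Require Import Defs.
From mathcomp Require Import all_boot all_order all_fingroup all_algebra.
From mathcomp Require Import all_classical.
From mathcomp Require Import zify ring.

(** Write [F, G] for the bracket iota_F G - iota_G F, S for the Euler form, M
for the sum of the N_i and nu = [M, mu].

Everything rests on three facts.

- The Euler form counts degree: [S, F] = a F for every symmetric form F of
  degree a ([bracket_euler]). Hence [S, mu] = mu, [S, nu] = nu and [S, M] = 0.

- Arguments have degrees between -n and -1, so a form of degree a takes a list
  of m arguments to degree at most a - m and vanishes as soon as m > n + a
  ([form_eq0_by_degree]). As arities add up under insertion (minus one), the
  bound 2 k_i >= n + 3 puts [M, nu] in arities at least n + 2, while it has
  degree 1; therefore [M, [M, mu]] = 0. The same count, applied to one N_i,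
  leaves in [N_i, mu] only the components l_m with m <= n + 2 - k_i
  ([bracket_vcomp_sum]).

- Insertion is a graded pre-Lie product ([iota_prelie]).

The first two facts give the Nijenhuis identities: with S + M in place of N both
[N, [N, mu]] and [S + 2 M, mu] equal mu + 2 nu, and [S + M, S + 2 M] =
[S + M, M] = 0. They also give the formula for the deformed structure mu + nu.
It remains to see that mu + nu squares to zero. Degree alone does not kill
iota_nu nu, which has degree 2 and may live in arity n + 2; but the pre-Lie
identity derives iota_mu nu + iota_nu mu = 0 and iota_nu nu = 0 from
iota_mu mu = 0 and [M, nu] = 0 ([iota_square_deformed]).

To prove the pre-Lie identity one needs a workable form of the signed sum over
unshuffles. The recursive sum [usum] goes through a list and sends each entry to
the left or to the right block; coassociativity and graded cocommutativity of
unshuffling become short inductions ([usum_assoc], [usumC]). The permutations of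
the definition are matched with it through the set of indices that they send
to the left block ([unshuffle_sum]). Since that definition splits arbitrary
arguments into homogeneous parts, forms are compared on homogeneous lists only,
which is enough by multilinearity ([multilinear_ext]). *)

Set Implicit Arguments.
Unset Strict Implicit.
Unset Printing Implicit Defensive.

Import Order.TTheory GRing.Theory Num.Theory.

Local Open Scope ring_scope.

(* Graded symmetric multilinear maps, not symmetric bilinear forms. *)
Local Notation symform := Defs.symmetric_form.

(** * Signed sums over unshuffles of a list *)

Section Signs.
Variable K : numFieldType.

Local Notation sg z := ((-1 : K) ^ z).

Lemma sgD (a b : int) : sg (a + b) = sg a * sg b.
Proof. by rewrite expfzDr // oppr_eq0 oner_eq0. Qed.

Lemma sg_parity (c a b : int) : a = b + 2 * c -> sg a = sg b.
Proof.
by move=> ->; rewrite sgD -exprz_exp -exprnP sqrrN expr1n exp1rz mulr1.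
Qed.

End Signs.

Section UnshuffleSums.
Variables (K : numFieldType) (V : lmodType K) (X : eqType) (deg : X -> int).

Local Notation sg z := ((-1 : K) ^ z).

Implicit Types (l r t : seq X) (phi psi : seq X -> seq X -> V).

Definition sdeg t : int := \sum_(x <- t) deg x.

(** The sum of phi l r over all ways to unshuffle t into a left block l and a
right block r, with Koszul sign: an entry put into the right block is passed
by all entries of the left block that come after it. *)
Fixpoint usum t phi : V :=
  if t is x :: t' then
    usum t' (fun l r => phi (x :: l) r)
    + usum t' (fun l r => sg (deg x * sdeg l) *: phi l (x :: r))
  else phi [::] [::].

Lemma sdeg_cons x t : sdeg (x :: t) = deg x + sdeg t.
Proof. by rewrite /sdeg big_cons. Qed.

Lemma sdeg_cat l r : sdeg (l ++ r) = sdeg l + sdeg r.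
Proof. by rewrite /sdeg big_cat. Qed.

Lemma sdeg_perm l r : perm_eq l r -> sdeg l = sdeg r.
Proof. exact: perm_big. Qed.

Lemma eq_usum t phi psi :
  (forall l r, perm_eq (l ++ r) t -> phi l r = psi l r) ->
  usum t phi = usum t psi.
Proof.
elim: t phi psi => [|x t IH] phi psi eq_pp /=; first exact: eq_pp.
congr (_ + _); apply: IH => l r lr; first by rewrite eq_pp //= perm_cons.
congr (_ *: _); apply: eq_pp.
by rewrite -(cat1s x r) perm_catCA /= perm_cons.
Qed.

Lemma usumD t phi psi :
  usum t (fun l r => phi l r + psi l r) = usum t phi + usum t psi.
Proof.
elim: t phi psi => [//|x t IH] phi psi /=; rewrite IH addrACA; congr (_ + _).
by rewrite -IH; apply: eq_usum => l r _; rewrite scalerDr.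
Qed.

Lemma usumZ t c phi : usum t (fun l r => c *: phi l r) = c *: usum t phi.
Proof.
elim: t phi => [//|x t IH] phi /=; rewrite IH scalerDr -IH; congr (_ + _).
by rewrite -IH; apply: eq_usum => l r _; rewrite !scalerA mulrC.
Qed.

Lemma usum0 t phi :
  (forall l r, perm_eq (l ++ r) t -> phi l r = 0) -> usum t phi = 0.
Proof.
move=> phi0; rewrite (@eq_usum _ _ (fun l r => (0 : K) *: phi l r)) ?usumZ
  ?scale0r //.
by move=> l r /phi0 ->; rewrite scaler0.
Qed.

Lemma usum_sum (I : Type) (s : seq I) (P : pred I) t (phi : I -> seq X ->
  seq X -> V) :
  usum t (fun l r => \sum_(i <- s | P i) phi i l r) =
  \sum_(i <- s | P i) usum t (phi i).
Proof.
elim: s => [|i s IH]; first by rewrite big_nil usum0 // => l r _;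
  rewrite big_nil.
rewrite big_cons -IH; case: ifP => Pi; [rewrite -usumD|];
  apply: eq_usum => l r _;
  by rewrite big_cons Pi.
Qed.

(** Coassociativity: an unshuffle into three blocks can be made by splitting the
right block or the left block of an unshuffle into two. *)
Lemma usum_assoc t (phi : seq X -> seq X -> seq X -> V) :
  usum t (fun l r => usum r (phi l)) =
  usum t (fun c b => usum c (fun l a => phi l a b)).
Proof.
elim: t phi => [//|x t IH] phi /=; rewrite usumD IH -addrA; congr (_ + _).
rewrite (@eq_usum _ (fun l r => _ *: _)
  (fun l r => sg (deg x * sdeg l) *: usum r (fun a b => phi l (x :: a) b) +
   usum r (fun a b => sg (deg x * sdeg (l ++ a)) *: phi l a (x :: b))));
     last first.
  move=> l r _; rewrite scalerDr -[in X in _ + X]usumZ; congr (_ + _).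
  by apply: eq_usum => a b _; rewrite scalerA -sgD -mulrDr sdeg_cat.
rewrite usumD; congr (_ + _).
  rewrite -(IH (fun l a b => sg (deg x * sdeg l) *: phi l (x :: a) b)).
  by apply: eq_usum => l r _; rewrite -usumZ.
rewrite IH; apply: eq_usum => c b _; rewrite -usumZ; apply: eq_usum => l a la.
by rewrite (sdeg_perm la).
Qed.

(** Graded cocommutativity: exchanging the two blocks costs the sign of moving
one past the other. *)
Lemma usumC t phi :
  usum t phi = usum t (fun l r => sg (sdeg l * sdeg r) *: phi r l).
Proof.
elim: t phi => [|x t IH] phi /=; first by rewrite /sdeg big_nil scale1r.
rewrite addrC; congr (_ + _).
  rewrite IH; apply: eq_usum => l r _; rewrite scalerA -sgD sdeg_cons.
  by congr ((-1) ^ _ *: _); ring.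
rewrite IH; apply: eq_usum => l r _; rewrite scalerA -sgD sdeg_cons.
by congr (_ *: _); apply: (@sg_parity _ (- (deg x * sdeg l))); ring.
Qed.

Lemma usumCA t (phi : seq X -> seq X -> seq X -> V) :
  usum t (fun l r => usum r (phi l)) =
  usum t (fun l r => usum r (fun a b => sg (sdeg l * sdeg a) *: phi a l b)).
Proof.
by rewrite !usum_assoc; apply: eq_usum => c b _; rewrite usumC.
Qed.

(** Exchanging two adjacent entries of t changes the sum by their Koszul sign.
If they go to the same block, phi contributes this sign; if they are
separated, it comes from the unshuffle. *)
Lemma usum_swap x y t1 t2 phi :
  (forall l1 l2 r, phi (l1 ++ x :: y :: l2) r =
     sg (deg x * deg y) *: phi (l1 ++ y :: x :: l2) r) ->
  (forall l r1 r2, phi l (r1 ++ x :: y :: r2) =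
     sg (deg x * deg y) *: phi l (r1 ++ y :: x :: r2)) ->
  usum (t1 ++ x :: y :: t2) phi =
  sg (deg x * deg y) *: usum (t1 ++ y :: x :: t2) phi.
Proof.
elim: t1 phi => [|z t1 IH] phi phil phir /=; last first.
  rewrite scalerDr; congr (_ + _); apply: IH => *.
  - exact: (phil (_ :: _)).
  - exact: phir.
  - rewrite phil !scalerA !sdeg_cat !sdeg_cons; congr (_ *: _).
    by rewrite -!sgD; congr (_ ^ _); ring.
  - rewrite (phir _ (_ :: _)) !scalerA; congr (_ *: _).
    by rewrite -!sgD; congr (_ ^ _); ring.
rewrite !scalerDr -!addrA; congr (_ + _).
  by rewrite -usumZ; apply: eq_usum => l r _; rewrite (phil [::]).
rewrite addrCA; congr (_ + _); last congr (_ + _).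
- rewrite -usumZ; apply: eq_usum => l r _; rewrite sdeg_cons scalerA -sgD.
  by congr (_ ^ _ *: _); ring.
- rewrite -usumZ; apply: eq_usum => l r _; rewrite sdeg_cons scalerA -sgD.
  congr (_ *: _); apply: (@sg_parity _ (- (deg x * deg y))); ring.
- rewrite -usumZ; apply: eq_usum => l r _; rewrite (phir _ [::]) !scalerA.
  by congr (_ *: _); rewrite -!sgD; congr (_ ^ _); ring.
Qed.

Lemma usum_only_nil_left t phi :
  (forall x l r, phi (x :: l) r = 0) -> usum t phi = phi [::] t.
Proof.
elim: t phi => [//|x t IH] phi phi0 /=.
rewrite usum0 // add0r IH => [|y l r]; last by rewrite phi0 scaler0.
by rewrite /sdeg big_nil mulr0 scale1r.
Qed.

Lemma usum_only_nil_right t phi :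
  (forall l x r, phi l (x :: r) = 0) -> usum t phi = phi t [::].
Proof.
elim: t phi => [//|x t IH] phi phi0 /=.
rewrite IH => [|l y r]; last by rewrite phi0.
by rewrite [X in _ + X]usum0 ?addr0 // => l r _; rewrite phi0 scaler0.
Qed.

End UnshuffleSums.

Lemma usum_map (K : numFieldType) (V : lmodType K) (X Y : eqType)
  (deg : X -> int) (Z : Y -> X) t phi :
  @usum K V X deg (map Z t) phi =
  usum (deg \o Z) t (fun l r => phi (map Z l) (map Z r)).
Proof.
elim: t phi => [//|x t IH] phi /=; rewrite !IH; congr (_ + _).
by apply: eq_usum => l r _; rewrite /sdeg big_map.
Qed.

(** * Unshuffling permutations and subsets of indices *)

Section Unshuffles.
Variables (K : numFieldType) (V : lmodType K) (m : nat) (d : 'I_m -> int).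
Local Notation sg z := ((-1 : K) ^ z).
Local Notation ltI := (fun i j : 'I_m => (i < j)%N).

Lemma ltI_trans : transitive ltI.
Proof. by move=> j i k; apply: ltn_trans. Qed.

Lemma sorted_enum_ord : sorted ltI (enum 'I_m).
Proof.
by have := iota_ltn_sorted 0 m; rewrite -val_enum_ord sorted_map.
Qed.

(** The Koszul sign of the unshuffle of a sorted list s whose left block
consists of the entries in A. *)
Definition subset_sign (s : seq 'I_m) (A : {set 'I_m}) : K :=
  \prod_(i <- s | i \notin A)
     \prod_(j <- s | (j \in A) && (i < j)%N) sg (d i * d j).

Lemma sg_sdeg c (s : seq 'I_m) :
  sg (c * sdeg d s) = \prod_(j <- s) sg (c * d j).
Proof.
elim: s => [|j s IH]; first by rewrite /sdeg !big_nil mulr0.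
by rewrite big_cons sdeg_cons mulrDr sgD IH.
Qed.

(** Sortedness makes the comparison of indices in [subset_sign] agree with the
comparison of positions that the recursion of [usum] uses. *)
Lemma usum_over_subsets (s : seq 'I_m) (phi : seq 'I_m -> seq 'I_m -> V) :
  sorted ltI s ->
  usum d s phi = \sum_(A : {set 'I_m} | A \subset s)
    subset_sign s A *: phi [seq i <- s | i \in A] [seq i <- s | i \notin A].
Proof.
elim: s phi => [|x s IH] phi /= s_sorted.
  rewrite (big_pred1 finset.set0) => [|A].
    by rewrite /subset_sign big_nil scale1r.
  by rewrite -[RHS]finset.subset0; apply: eq_subset_r => i; rewrite !inE.
have x_lt : all (fun j : 'I_m => x < j)%N s by
  rewrite (order_path_min ltI_trans).
have xNs : x \notin s by apply/negP => /(allP x_lt); rewrite ltnn.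
have sub_s (A : {set 'I_m}) : (A \subset x :: s) && (x \notin A) =
  (A \subset s).
  apply/andP/fintype.subsetP => [[/fintype.subsetP As xA] i iA|As].
    by have := As i iA; rewrite inE => /predU1P[ix|//]; rewrite -ix iA in xA.
  split; last by apply: contra xNs => /As.
  by apply/fintype.subsetP => i /As; rewrite inE orbC => ->.
rewrite (bigID (fun A : {set 'I_m} => x \in A)) /=; congr (_ + _); last first.
  rewrite (eq_bigl _ _ sub_s) IH ?(path_sorted s_sorted) //.
  apply: eq_bigr => A As; have := As; rewrite -sub_s => /andP[_ xA].
  rewrite (negPf xA) /= scalerA; congr (_ *: _).
  rewrite /subset_sign big_cons xA mulrC; congr (_ * _).
    rewrite sg_sdeg big_filter big_cons (negPf xA) /= big_seq_cond
      [RHS]big_seq_cond.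
    apply: eq_bigl => j; have [js|//] := boolP (j \in s).
    by rewrite (allP x_lt) ?andbT.
  by apply: eq_bigr => i _; rewrite big_cons (negPf xA).
rewrite (reindex_onto (fun A => x |: A) (fun A => A :\ x)) => [|A /andP[_ xA]];
  last first.
  by rewrite finset.setD1K.
rewrite IH ?(path_sorted s_sorted) //; apply: eq_big => [A|A As].
  rewrite finset.setU11 andbT -sub_s; apply/andP/andP => -[].
    move=> As xA; split; last by rewrite finset.setU1K.
    by apply/fintype.subsetP => i;
      rewrite !inE => /predU1P[->|/(fintype.subsetP As)]; rewrite ?eqxx // inE.
  move=> As /eqP xA; split; last by rewrite -xA finset.setD11.
  by apply: fintype.subset_trans As; rewrite finset.subsetUr.
have eqA (i : 'I_m) : i \in s -> (i \in x |: A) = (i \in A).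
  by move=> i_s; rewrite !inE; case: eqP i_s xNs => [->|] // ->.
rewrite finset.setU11 /=; congr (_ *: phi (_ :: _) _); last 2 first.
- by apply: eq_in_filter => i /eqA.
- by apply: eq_in_filter => i /eqA ->.
rewrite /subset_sign big_cons finset.setU11 /= big_seq_cond [RHS]big_seq_cond;
  apply: eq_big => i.
  by have [/eqA->|//] := boolP (i \in s).
case/andP=> i_s _; rewrite big_cons finset.setU11 /=.
rewrite ltnNge (ltnW (allP x_lt _ i_s)) /= big_seq_cond [RHS]big_seq_cond.
by apply: eq_bigl => j; have [/eqA->|//] := boolP (j \in s).
Qed.

Section Perms.
Variables (k : nat) (k_le : (k <= m)%N).

Definition first_block : {set 'I_m} := [set i : 'I_m | (i < k)%N].

Lemma sorted_enum_set (A : {set 'I_m}) : sorted ltI (enum A).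
Proof.
rewrite /enum_mem; apply: sorted_filter; first exact: ltI_trans.
by rewrite -enumT; exact: sorted_enum_ord.
Qed.

Lemma nth_enum_set_lt (A : {set 'I_m}) x0 (i j : nat) :
  (i < j)%N -> (j < #|A|)%N -> (nth x0 (enum A) i < nth x0 (enum A) j)%N.
Proof.
move=> ij jA; have := sorted_ltn_nth ltI_trans x0 (sorted_enum_set A).
by move=> /(_ i j); rewrite !inE -!cardE jA (ltn_trans ij jA); apply.
Qed.

Lemma take_enum_ord : take k (enum 'I_m) = enum first_block.
Proof.
apply: (irr_sorted_eq ltI_trans) => [i|||i]; rewrite /= ?ltnn //.
- exact/take_sorted/sorted_enum_ord.
- exact: sorted_enum_set.
by rewrite mem_enum inE in_take ?mem_enum // index_enum_ord.
Qed.

Lemma drop_enum_ord : drop k (enum 'I_m) = enum (~: first_block).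
Proof.
apply: (irr_sorted_eq ltI_trans) => [i|||i]; rewrite /= ?ltnn //.
- exact/drop_sorted/sorted_enum_ord.
- exact: sorted_enum_set.
have := mem_enum 'I_m i; rewrite -[X in _ \in X](cat_take_drop k).
have := enum_uniq 'I_m; rewrite -[X in uniq X](cat_take_drop k) cat_uniq.
case/and3P=> _ /hasPn dis _; rewrite mem_cat.
rewrite mem_enum finset.in_setC -(mem_enum first_block) -take_enum_ord.
by case: (boolP (i \in drop _ _)) => [/dis/negPf -> //|_]; rewrite orbF => ->.
Qed.

Lemma unshuffleP (sigma : 'S_m) :
  reflect (forall i j : 'I_m, (i < j)%N -> (j < k)%N || (k <= i)%N ->
             (sigma i < sigma j)%N)
          (sigma \in unshuffles k m).
Proof.
rewrite inE; apply: (iffP forallP) => sh i.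
  by move=> j ij jk; have /forallP/(_ j) := sh i; rewrite ij jk.
by apply/forallP => j; apply/implyP => /andP[]; exact: sh.
Qed.

(** An unshuffle is increasing on each block, so its two blocks of values are
the sorted enumerations of a set and of its complement. *)
Lemma unshuffle_map (sigma : 'S_m) : sigma \in unshuffles k m ->
  let A := sigma @: first_block in map sigma (enum 'I_m) =
    enum A ++ enum (~: A).
Proof.
move=> /unshuffleP sh A; rewrite -[in LHS](cat_take_drop k (enum 'I_m)) map_cat.
have sorted_map_sigma (B : {set 'I_m}) :
    {in B &, forall i j : 'I_m, (i < j)%N -> (j < k)%N || (k <= i)%N} ->
    map sigma (enum B) = enum (sigma @: B).
  move=> Bsh; apply: (irr_sorted_eq ltI_trans) => [i|||i]; rewrite /= ?ltnn //.
  - apply: (@homo_sorted_in _ _ (mem B) _ ltI); last exact: sorted_enum_set.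
      by move=> i j iB jB ij; apply: sh => //; apply: Bsh.
    by apply/allP => i; rewrite mem_enum.
  - exact: sorted_enum_set.
  rewrite mem_enum; apply/mapP/imsetP => -[j jB ->]; exists j => //.
    by rewrite mem_enum in jB.
  by rewrite mem_enum.
rewrite take_enum_ord drop_enum_ord !sorted_map_sigma.
- suff -> : sigma @: (~: first_block) = ~: A by [].
  apply/finset.setP => i; rewrite inE -(permKV sigma i).
  by rewrite !mem_imset ?inE //; apply: perm_inj.
- by move=> i j; rewrite !inE -leqNgt => -> _ _; rewrite orbT.
- by move=> i j; rewrite !inE => _ ->.
Qed.

Definition block_seq (A : {set 'I_m}) := enum A ++ enum (~: A).

Lemma size_block_seq A : size (block_seq A) = m.
Proof. by rewrite size_cat -!cardE cardsC card_ord. Qed.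

Lemma block_seq_uniq A : uniq (block_seq A).
Proof.
rewrite cat_uniq !enum_uniq andbT; apply/hasPn => i.
by rewrite !mem_enum inE.
Qed.

Lemma block_seq_inj A : injective (fun i : 'I_m => nth i (block_seq A) i).
Proof.
move=> i j /eqP; rewrite (set_nth_default i) ?size_block_seq //.
by rewrite nth_uniq ?size_block_seq ?block_seq_uniq // => /eqP/val_inj.
Qed.

(** The unshuffle whose left block takes its values in A. *)
Definition block_perm A : 'S_m := perm (@block_seq_inj A).

Lemma map_block_perm A : map (block_perm A) (enum 'I_m) = block_seq A.
Proof.
have size_eq : size (map (block_perm A) (enum 'I_m)) = size (block_seq A).
  by rewrite size_map size_enum_ord size_block_seq.
case: (pickP 'I_m) => [x0 _|no]; last first.
  have m0 : m = 0%N by rewrite -(card_ord m) eq_card0.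
  have /size0nil sA : size (block_seq A) = 0%N by rewrite size_block_seq m0.
  by move: size_eq; rewrite sA => /size0nil.
apply: (eq_from_nth (x0 := x0) size_eq) => i;
  rewrite size_map size_enum_ord => im.
rewrite (nth_map x0) ?size_enum_ord // permE.
have -> : nth x0 (enum 'I_m) i = Ordinal im by apply: val_inj;
  rewrite /= nth_enum_ord.
by apply: set_nth_default; rewrite size_block_seq.
Qed.

Lemma block_permE A i : block_perm A i = nth i (block_seq A) i.
Proof. by rewrite permE. Qed.

Lemma card_first_block : #|first_block| = k.
Proof.
by rewrite cardE -take_enum_ord size_take size_enum_ord; case: ltngtP k_le.
Qed.

Lemma block_perm_image (A : {set 'I_m}) : #|A| = k ->
  block_perm A @: first_block = A.
Proof.
move=> cA; apply/eqP; rewrite eqEcard card_imset; last exact: perm_inj.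
rewrite card_first_block cA leqnn andbT;
  apply/fintype.subsetP => _ /imsetP[i ik ->].
rewrite inE in ik; rewrite block_permE nth_cat -cardE cA ik.
by rewrite -(mem_enum A) mem_nth // -cardE cA.
Qed.

Lemma block_perm_unshuffle (A : {set 'I_m}) : #|A| = k ->
  block_perm A \in unshuffles k m.
Proof.
move=> cA; apply/unshuffleP => i j ij;
  rewrite !block_permE !nth_cat -!cardE !cA.
have sc : size (enum (~: A)) = (m - k)%N.
  by have := cardsC A; rewrite -cardE cA card_ord; lia.
case/orP=> [jk|ki].
  have ik := ltn_trans ij jk;
    rewrite ik jk (set_nth_default i j) -?cardE ?cA //.
  by apply: nth_enum_set_lt; rewrite ?cA.
have kj := leq_ltn_trans ki ij; rewrite (leq_gtF ki) (leq_gtF (ltnW kj)).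
rewrite (set_nth_default i j) ?sc; last by have := ltn_ord j; lia.
by apply: nth_enum_set_lt; rewrite ?[X in (_ < X)%N]cardE ?sc;
  have := ltn_ord j; lia.
Qed.

(** The pairs inverted by an unshuffle have one index in each block, so they
correspond to the pairs of values counted in [subset_sign], in reverse
order. *)
Lemma koszul_subset_sign (sigma : 'S_m) : sigma \in unshuffles k m ->
  koszul K d sigma = subset_sign (enum 'I_m) (sigma @: first_block).
Proof.
move=> /unshuffleP sh; rewrite /subset_sign big_enum_cond /=.
under [RHS]eq_bigr do rewrite big_enum_cond /=.
rewrite pair_big_dep /=
  (reindex (fun p : 'I_m * 'I_m => (sigma p.2, sigma p.1))) /=.
  apply: eq_big => [[i j]|[i j] _] /=; last by rewrite mulrC.
  rewrite !mem_imset ?inE; try exact: perm_inj.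
  case: (ltnP (sigma j) (sigma i)) => [ji|_]; last by rewrite !andbF.
  rewrite !andbT; apply/idP/idP => [ij|]; last by move=> ?; lia.
  rewrite -leqNgt; apply: contraLR ji; rewrite -leqNgt negb_and -ltnNge -leqNgt.
  by move=> jk; apply/ltnW/sh.
exists (fun p => ((sigma^-1)%g p.2, (sigma^-1)%g p.1)) => -[i j] _ /=;
  by rewrite ?permK ?permKV.
Qed.

(** The signed sum over (k, m - k)-unshuffles of permutations is the part of
[usum] with left block of size k: sending a permutation to the image of its
first k indices is a bijection onto the subsets of size k, with inverse
[block_perm]. *)
Lemma unshuffle_sum (phi : seq 'I_m -> seq 'I_m -> V) :
  \sum_(sigma in unshuffles k m) koszul K d sigma *:
     phi (take k (map sigma (enum 'I_m))) (drop k (map sigma (enum 'I_m))) =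
  usum d (enum 'I_m) (fun l r => if size l == k then phi l r else 0).
Proof.
rewrite usum_over_subsets ?sorted_enum_ord //.
have filterE (A : {set 'I_m}) : [seq i <- enum 'I_m | i \in A] = enum A.
  apply: (irr_sorted_eq ltI_trans) => [i|||i]; rewrite /= ?ltnn //.
  - by apply: sorted_filter; [exact: ltI_trans | exact: sorted_enum_ord].
  - exact: sorted_enum_set.
  by rewrite mem_filter !mem_enum andbT.
transitivity (\sum_(A : {set 'I_m} | #|A| == k)
   subset_sign (enum 'I_m) A *: phi (enum A) (enum (~: A))); last first.
  rewrite big_mkcond [RHS]big_mkcond; apply: eq_bigr => A _.
  have -> : A \subset enum 'I_m by apply/fintype.subsetP => i _;
    rewrite mem_enum.
  rewrite filterE -cardE; case: ifP => _; last by rewrite scaler0.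
  congr (_ *: phi _ _); rewrite -filterE; apply: eq_filter => i.
  by rewrite inE.
rewrite (reindex_onto (fun sigma : 'S_m => sigma @: first_block) block_perm) =>
  [|A /eqP cA]; last first.
  exact: block_perm_image.
apply: eq_big => [sigma|sigma sh]; last first.
  rewrite koszul_subset_sign // unshuffle_map //.
  have cA : size (enum (sigma @: first_block)) = k.
    by rewrite -cardE card_imset ?card_first_block //; exact: perm_inj.
  by rewrite take_size_cat // drop_size_cat.
rewrite card_imset ?card_first_block ?eqxx /=; last exact: perm_inj.
apply/idP/eqP => [sh|<-]; last first.
  by rewrite block_perm_unshuffle // card_imset ?card_first_block //;
    exact: perm_inj.
have := map_block_perm (sigma @: first_block);
  rewrite -[RHS]unshuffle_map // => eq_map.
apply/permP => i; move/eq_in_map: eq_map; apply.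
by rewrite mem_enum.
Qed.

End Perms.
End Unshuffles.

(** * Decomposition of arguments into homogeneous parts *)

Section HomogeneousExpansion.
Variables (K : numFieldType) (E : gradedLmodType K).
Local Notation T := (int * E)%type.
Implicit Types (F G H : vform E) (x y : E) (s : seq E) (t : seq T) (g :
  seq T -> E).

Lemma gpart0 i : gpart i (0 : E) = 0.
Proof.
have := gpart_linear i (-1) (0 : E) 0.
by rewrite scaleN1r oppr0 addr0 scaleN1r addNr.
Qed.

Lemma homog_gpart i (x : E) : homog i (gpart i x).
Proof. by rewrite /homog gpart_gpart eqxx. Qed.

Lemma homog_gpart_neq i j (x : E) : homog j x -> i != j -> gpart i x = 0.
Proof. by move=> /eqP <- /negPf ij; rewrite gpart_gpart ij. Qed.

Lemma homogD i (x y : E) : homog i x -> homog i y -> homog i (x + y).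
Proof.
rewrite /homog => /eqP hx /eqP hy.
by have := gpart_linear i 1 x y; rewrite !scale1r hx hy => ->.
Qed.

Lemma homog0 i : homog i (0 : E).
Proof. by rewrite /homog gpart0. Qed.

Lemma homogZ i a (x : E) : homog i x -> homog i (a *: x).
Proof.
rewrite /homog => /eqP hx.
by have := gpart_linear i a x 0; rewrite !addr0 hx gpart0 addr0 => ->.
Qed.

Definition homog_args t := all (fun p : T => homog p.1 p.2) t.

Local Notation vec t := [seq p.2 | p <- t].

Section Multilinear.
Variables (F : vform E) (F_ml : multilinear_form F).

Lemma multilinear0 s1 s2 : F (s1 ++ 0 :: s2) = 0.
Proof.
have := F_ml s1 s2 (-1) 0 0.
by rewrite scaleN1r oppr0 addr0 scaleN1r addNr.
Qed.

Lemma multilinearD s1 s2 x y : F (s1 ++ (x + y) :: s2) =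
  F (s1 ++ x :: s2) + F (s1 ++ y :: s2).
Proof. by have := F_ml s1 s2 1 x y; rewrite !scale1r. Qed.

Lemma multilinearZ s1 s2 a x : F (s1 ++ (a *: x) :: s2) =
  a *: F (s1 ++ x :: s2).
Proof. by have := F_ml s1 s2 a x 0; rewrite !addr0 multilinear0 addr0. Qed.

Lemma multilinear_sum (I : Type) (r : seq I) (f : I -> E) s1 s2 :
  F (s1 ++ (\sum_(i <- r) f i) :: s2) = \sum_(i <- r) F (s1 ++ f i :: s2).
Proof.
by elim: r => [|i r IH];
  rewrite ?big_nil ?multilinear0 // !big_cons multilinearD IH.
Qed.

Lemma multilinear_zero_arg s : 0 \in s -> F s = 0.
Proof. by move=> /path.splitPr[s1 s2]; exact: multilinear0. Qed.

Lemma multilinear_usum (deg : T -> int) t phi s2 :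
  F (usum deg t phi :: s2) = usum deg t (fun l r => F (phi l r :: s2)).
Proof.
elim: t phi => [//|x t IH] phi /=; rewrite (multilinearD [::]) /= !IH;
  congr (_ + _).
by apply: eq_usum => l r _; rewrite (multilinearZ [::]).
Qed.

End Multilinear.

(** All nonzero homogeneous parts of the entries of s have their degree in I.
Such a finite I reduces every sum over degrees to a sum over I. *)
Definition covers (I : seq int) s :=
  forall x i, x \in s -> i \notin I -> gpart i x = 0.

Lemma covers_cons I x s :
  covers I (x :: s) <-> (forall i, i \notin I -> gpart i x = 0) /\ covers I s.
Proof.
split=> [cov|[covx covs] y i]; last by rewrite inE => /predU1P[->|];
  [exact: covx | exact: covs].
by split=> [i|y i ys]; apply: cov; rewrite inE ?eqxx ?ys ?orbT.
Qed.

Lemma covers_exists s : exists2 I, uniq I & covers I s.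
Proof.
elim: s => [|x s [I uI IH]]; first by exists [::] => // x.
have /finite_seqP[J Jx] := gpart_finite x.
exists (undup (J ++ I)); first exact: undup_uniq.
apply/covers_cons; split=> [i|y i ys];
  rewrite mem_undup mem_cat negb_or => /andP[iJ iI].
  apply/eqP; apply: contraNT iJ => gx.
  have : [set i | gpart i x != 0]%classic i by [].
  by rewrite Jx.
exact: IH.
Qed.

Lemma sum_gpart I x : uniq I -> (forall i, i \notin I -> gpart i x = 0) ->
  \sum_(i <- I) gpart i x = x.
Proof.
move=> uI cov; rewrite -[RHS]gpart_sum (fsbigE I) //;
  first by apply: eq_bigl => i; rewrite in_setT.
by move=> i _; exact: cov.
Qed.

(** The sum of g over the lists obtained by replacing each entry of s by one of
its homogeneous parts, paired with its degree. *)
Fixpoint hsum (I : seq int) s g : E :=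
  if s is x :: s' then \sum_(i <- I) hsum I s'
    (fun t => g ((i, gpart i x) :: t))
  else g [::].

Lemma eq_hsum I s g1 g2 :
  (forall t, homog_args t -> size t = size s -> g1 t = g2 t) ->
    hsum I s g1 = hsum I s g2.
Proof.
elim: s g1 g2 => [|x s IH] g1 g2 eqg /=; first exact: eqg.
apply: eq_bigr => i _; apply: IH => t ht st; apply: eqg; rewrite /= ?st //.
by rewrite homog_gpart.
Qed.

Lemma hsumD I s g1 g2 : hsum I s (fun t => g1 t + g2 t) =
  hsum I s g1 + hsum I s g2.
Proof.
elim: s g1 g2 => [//|x s IH] g1 g2 /=; rewrite -big_split.
by apply: eq_bigr => i _; rewrite IH.
Qed.

Lemma hsumZ I s a g : hsum I s (fun t => a *: g t) = a *: hsum I s g.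
Proof.
elim: s g => [//|x s IH] g /=; rewrite scaler_sumr.
by apply: eq_bigr => i _; rewrite IH.
Qed.

Lemma hsum_eq0 I s g : (forall t, g t = 0) -> hsum I s g = 0.
Proof.
move=> g0; rewrite (@eq_hsum _ _ _ (fun t => (0 : K) *: g t)) ?hsumZ ?scale0r
  // => t _ _.
by rewrite g0 scaler0.
Qed.

Lemma hsum_sum (J : Type) (r : seq J) (P : pred J) I s (g : J -> seq T -> E) :
  hsum I s (fun t => \sum_(j <- r | P j) g j t) =
    \sum_(j <- r | P j) hsum I s (g j).
Proof.
elim: r => [|j r IH]; first by rewrite big_nil hsum_eq0 // => t;
  rewrite big_nil.
rewrite big_cons -IH; case: ifP => Pj; [rewrite -hsumD|];
  apply: eq_hsum => t _ _;
  by rewrite big_cons Pj.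
Qed.

Lemma multilinear_expand F I s p q : multilinear_form F -> uniq I ->
  covers I s ->
  F (p ++ s ++ q) = hsum I s (fun t => F (p ++ vec t ++ q)).
Proof.
move=> F_ml uI; elim: s p => [//|x s IH] p /covers_cons[covx covs] /=.
rewrite -[X in F (_ ++ X :: _)](sum_gpart uI covx) multilinear_sum //.
by apply: eq_bigr => i _; rewrite -cat_rcons IH //; apply: eq_hsum => t _ _;
  rewrite cat_rcons.
Qed.

(** Multilinear maps are determined by their values on homogeneous arguments. *)
Lemma multilinear_ext F G : multilinear_form F -> multilinear_form G ->
  (forall t, homog_args t -> F (vec t) = G (vec t)) -> F = G.
Proof.
move=> F_ml G_ml FG; apply/funext => s.
have [I uI cov] := covers_exists s.
have := multilinear_expand [::] [::] F_ml uI cov;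
  have := multilinear_expand [::] [::] G_ml uI cov.
rewrite /= !cats0 => -> ->; apply: eq_hsum => t ht _; rewrite !cats0; exact: FG.
Qed.

Definition vanish_zero g := forall t, 0 \in vec t -> g t = 0.

Lemma hsum_homog_args I t g : uniq I -> {subset map fst t <= I} ->
  homog_args t ->
  vanish_zero g -> hsum I (vec t) g = g t.
Proof.
move=> uI; elim: t g => [//|[e x] t IH] g sub /= /andP[/= hx ht] g0.
have eI : e \in I by apply: sub; rewrite inE eqxx.
rewrite (bigD1_seq e) //= [X in _ + X]big1 => [|i ie]; last first.
  rewrite (homog_gpart_neq hx ie) hsum_eq0 // => u; apply: g0.
  by rewrite inE eqxx.
rewrite addr0 (eqP hx) IH // => [i it|u u0]; first by apply: sub;
  rewrite inE it orbT.
by apply: g0; rewrite inE u0 orbT.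
Qed.

Fixpoint words (I : seq int) (m : nat) : seq (seq int) :=
  if m is m'.+1 then [seq i :: l | i <- I, l <- words I m'] else [:: [::]].

Lemma mem_words I m l : (l \in words I m) = (size l == m) && all (mem I) l.
Proof.
elim: m l => [|m IH] l /=; first by rewrite inE -size_eq0; case: l.
apply/allpairsP/idP => [[[i w] /= [iI wI ->]] /=|].
  by rewrite eqSS iI /= -IH.
case: l => [//|i l] /=; rewrite eqSS => /and3P[sl iI lI].
by exists (i, l); split => //=; rewrite IH sl.
Qed.

Lemma words_uniq I m : uniq I -> uniq (words I m).
Proof.
move=> uI; elim: m => [//|m IH] /=; apply: allpairs_uniq => //.
by move=> [i l] [j w] _ _ [-> ->].
Qed.

Lemma hsum_words I s g :
  hsum I s g = \sum_(l <- words I (size s)) g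
    [seq (p.1, gpart p.1 p.2) | p <- zip l s].
Proof.
elim: s g => [|x s IH] g /=; first by rewrite big_seq1.
rewrite big_allpairs_dep; apply: eq_bigr => i _.
by rewrite IH.
Qed.

(** Degree vectors with an entry outside I contribute a list with a zero vector,
on which g vanishes, so the sum over all degree vectors is a finite one over
the words in I. *)
Lemma fsum_hsum I s g : uniq I -> covers I s -> vanish_zero g ->
  \sum_(d \in [set: {ffun 'I_(size s) -> int}])
     g [seq (d i, gpart (d i) (nth 0 s i)) | i <- enum 'I_(size s)] =
       hsum I s g.
Proof.
move=> uI cov g0; rewrite hsum_words; set m := size s.
pose ff l := [ffun i : 'I_m => nth (0 : int) l i].
have sz l : l \in words I m -> size l = m by rewrite mem_words => /andP[/eqP].
rewrite (fsbigE (map ff (words I m))) //; last 2 first.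
- rewrite map_inj_in_uniq ?words_uniq // => l w lI wI eq_lw.
  apply: (@eq_from_nth _ 0) => [|i]; rewrite sz // ?sz // => im.
  by have := congr1 (fun f : {ffun 'I_m -> int} => f (Ordinal im)) eq_lw;
    rewrite !ffunE.
- move=> d _ dI; apply: g0.
  have [i diI] : exists i, d i \notin I.
    apply/existsP; rewrite -negb_forall; apply: contra dI => /forallP dI.
    apply/mapP; exists [seq d i | i <- enum 'I_m].
      rewrite mem_words size_map size_enum_ord eqxx;
        apply/allP => _ /mapP[i _ ->].
      exact: dI.
    by apply/ffunP => j;
      rewrite ffunE (nth_map j) ?size_enum_ord // nth_ord_enum.
  apply/mapP; exists (d i, gpart (d i) (nth 0 s i));
    last by rewrite (cov _ _ _ diI) // mem_nth.
  by apply/mapP; exists i; rewrite // mem_enum.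
rewrite (eq_bigl xpredT) => [|d]; last by rewrite in_setT.
rewrite big_map big_seq [RHS]big_seq; apply: eq_bigr => l lI; congr g.
have szz : size (zip l s) = m by rewrite size_zip sz // minnn.
apply: (@eq_from_nth _ (0, 0)) => [|i];
  first by rewrite size_map size_enum_ord size_map szz.
rewrite size_map size_enum_ord => im.
rewrite (nth_map (Ordinal im)) ?size_enum_ord // (nth_map (0, 0)) ?szz //.
rewrite nth_zip ?sz //= ffunE.
by have -> : nth (Ordinal im) (enum 'I_m) i = Ordinal im by apply: val_inj;
  rewrite /= nth_enum_ord.
Qed.

End HomogeneousExpansion.

(** * Insertion of multilinear forms *)

Section Insertion.
Variables (K : numFieldType) (E : gradedLmodType K).
Local Notation T := (int * E)%type.
Local Notation deg := (fun p : T => p.1).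
Local Notation vec t := [seq p.2 | p <- t].
Local Notation sg z := ((-1 : K) ^ z).
Implicit Types (F G H : vform E) (x y : E) (s : seq E) (t l r : seq T).

(** The insertion of F into G on a list of homogeneous arguments paired with
their degrees. Summing over unshuffles with left blocks of every size
accounts for all arities of F at once. *)
Definition iota_homog F G t :
  E := usum deg t (fun l r => G (F (vec l) :: vec r)).

Lemma zero_in_split t l r : perm_eq (l ++ r) t ->
  (0 \in vec t) = (0 \in vec l) || (0 \in vec r).
Proof. by move=> /(perm_map snd)/perm_mem <-; rewrite map_cat mem_cat. Qed.

Lemma nested_zero F G l r : multilinear_form F -> multilinear_form G ->
  (0 \in vec l) || (0 \in vec r) -> G (F (vec l) :: vec r) = 0.
Proof.
move=> F_ml G_ml /orP[l0|r0];
  first by rewrite (multilinear_zero_arg F_ml l0) (multilinear0 G_ml [::]).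
by apply: (multilinear_zero_arg G_ml); rewrite inE r0 orbT.
Qed.

Lemma iota_homog_vanish_zero F G : multilinear_form F -> multilinear_form G ->
  vanish_zero (iota_homog F G).
Proof.
move=> F_ml G_ml t t0; apply: usum0 => l r lr.
by apply: (nested_zero F_ml G_ml); rewrite -(zero_in_split lr).
Qed.

Lemma insertion_hsum I k F G s : multilinear_form F -> multilinear_form G ->
  uniq I -> covers I s -> (k <= size s)%N ->
  insertion k F G s = hsum I s (fun t => usum deg t
    (fun l r => if size l == k then G (F (vec l) :: vec r) else 0)).
Proof.
move=> F_ml G_ml uI cov k_le; rewrite -fsum_hsum //; last first.
  move=> t t0; apply: usum0 => l r lr; case: ifP => // _.
  by apply: (nested_zero F_ml G_ml); rewrite -(zero_in_split lr).
apply: eq_fsbigr => d _; rewrite usum_map /=.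
pose X i := gpart (d i) (nth 0 s i).
have := @unshuffle_sum K E (size s) d k k_le
  (fun u v => G (F (map X u) :: map X v)).
rewrite /homog_insertion => eq_sum; transitivity (usum d (enum 'I_(size s))
   (fun u v => if size u == k then G (F (map X u) :: map X v) else 0)).
  by rewrite -eq_sum; apply: eq_bigr => sigma _;
    rewrite map_take map_drop -!(map_comp X sigma).
by apply: eq_usum => u v _; rewrite size_map -!map_comp.
Qed.

Lemma iota_form_hsum I F G s : multilinear_form F -> multilinear_form G ->
  uniq I -> covers I s -> iota_form F G s = hsum I s (iota_homog F G).
Proof.
move=> F_ml G_ml uI cov; rewrite /iota_form.
under eq_bigr => k _ do rewrite (insertion_hsum F_ml G_ml uI cov (ltn_ord k)).
rewrite -hsum_sum; apply: eq_hsum => t _ st; rewrite -usum_sum.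
apply: eq_usum => l r lr.
have lt_l : (size l < (size s).+1)%N.
  by rewrite ltnS -st -(perm_size lr) size_cat leq_addr.
rewrite (bigD1 (Ordinal lt_l)) //= eqxx big1 ?addr0 // => k.
by move=> /eqP ne; case: eqP => // lk; case: ne; apply: val_inj.
Qed.

(** On homogeneous arguments only the vector of their own degrees contributes,
so the decomposition into homogeneous parts disappears. *)
Lemma iota_formE_homog F G t : multilinear_form F -> multilinear_form G ->
  homog_args t ->
  iota_form F G (vec t) = iota_homog F G t.
Proof.
move=> F_ml G_ml ht; have uI := undup_uniq (map fst t).
have sub : {subset map fst t <= undup (map fst t)} by move=> i;
  rewrite mem_undup.
rewrite (@iota_form_hsum (undup (map fst t))) // ?hsum_homog_args //;
  first exact: iota_homog_vanish_zero.
move=> x i /mapP[[e y] /= ey ->] iI.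
have he : homog e y := allP ht _ ey.
apply: (homog_gpart_neq he); apply: contraNneq iI => ->.
by apply: sub; apply/mapP; exists (e, y).
Qed.

Lemma hsum_linear I s1 s2 a x y (g : seq T -> E) :
  (forall t1 t2 i x y, g (t1 ++ (i, a *: x + y) :: t2) =
     a *: g (t1 ++ (i, x) :: t2) + g (t1 ++ (i, y) :: t2)) ->
  hsum I (s1 ++ (a *: x + y) :: s2) g =
  a *: hsum I (s1 ++ x :: s2) g + hsum I (s1 ++ y :: s2) g.
Proof.
elim: s1 g => [|z s1 IH] g g_lin /=; rewrite scaler_sumr -big_split /=;
  apply: eq_bigr => i _; last by apply: IH => t1; apply: (g_lin (_ :: t1)).
rewrite -hsumZ -hsumD; apply: eq_hsum => t _ _.
by rewrite gpart_linear (g_lin [::]).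
Qed.

Lemma usum_linear t1 t2 i a x y (phi : seq T -> seq T -> E) :
  (forall l1 l2 r x y, phi (l1 ++ (i, a *: x + y) :: l2) r =
     a *: phi (l1 ++ (i, x) :: l2) r + phi (l1 ++ (i, y) :: l2) r) ->
  (forall l r1 r2 x y, phi l (r1 ++ (i, a *: x + y) :: r2) =
     a *: phi l (r1 ++ (i, x) :: r2) + phi l (r1 ++ (i, y) :: r2)) ->
  usum deg (t1 ++ (i, a *: x + y) :: t2) phi =
  a *: usum deg (t1 ++ (i, x) :: t2) phi + usum deg (t1 ++ (i, y) :: t2) phi.
Proof.
elim: t1 phi => [|z t1 IH] phi phil phir /=.
  rewrite scalerDr addrACA; congr (_ + _); rewrite -usumZ -usumD;
    apply: eq_usum => l r _.
    exact: (phil [::]).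
  by rewrite (phir _ [::]) scalerDr !scalerA mulrC.
rewrite scalerDr addrACA; congr (_ + _); apply: IH => *.
- exact: (phil (_ :: _)).
- exact: phir.
- by rewrite phil scalerDr !scalerA !sdeg_cat !sdeg_cons mulrC.
- by rewrite (phir _ (_ :: _)) scalerDr !scalerA mulrC.
Qed.

(** Decompose with one set of degrees I that covers all the arguments occurring
in the identity, which makes both sides sums over the same index set. *)
Lemma iota_multilinear F G : multilinear_form F -> multilinear_form G ->
  multilinear_form (iota_form F G).
Proof.
move=> F_ml G_ml s1 s2 a x y.
have [I uI cov] := covers_exists (s1 ++ s2 ++ [:: a *: x + y; x; y]).
have cov' z : z \in [:: a *: x + y; x; y] -> covers I (s1 ++ z :: s2).
  move=> zin w i; rewrite mem_cat inE => win; apply: cov.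
  rewrite !mem_cat; case/or3P: win => [->//|/eqP ->|->]; last by rewrite orbT.
  by rewrite zin !orbT.
rewrite !(@iota_form_hsum I) //; try by apply: cov'; rewrite !inE eqxx ?orbT.
apply: hsum_linear => t1 t2 i z w; apply: usum_linear => *; rewrite !map_cat /=.
  by rewrite F_ml -[RHS]/(a *: G ([::] ++ _ :: _) + G ([::] ++ _ :: _))
    -(G_ml [::]).
exact: (G_ml (_ :: _)).
Qed.

Lemma graded_symmetric_on_homog F : multilinear_form F ->
  (forall t1 t2 i j x y, homog_args t1 -> homog_args t2 -> homog i x ->
    homog j y ->
    F (vec t1 ++ x :: y :: vec t2) =
      sg (i * j) *: F (vec t1 ++ y :: x :: vec t2)) ->
  graded_symmetric F.
Proof.
move=> F_ml Fsym s1 s2 i j x y hx hy.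
have [I1 uI1 cov1] := covers_exists s1; have [I2 uI2 cov2] := covers_exists s2.
have expand z w : F (s1 ++ z :: w :: s2) =
    hsum I1 s1 (fun t1 =>
      hsum I2 s2 (fun t2 => F (vec t1 ++ z :: w :: vec t2))).
  rewrite (multilinear_expand [::] _ F_ml uI1 cov1);
    apply: eq_hsum => t1 _ _ /=.
  have := multilinear_expand (vec t1 ++ [:: z; w]) [::] F_ml uI2 cov2.
  rewrite cats0 -catA /= => ->; apply: eq_hsum => t2 _ _.
  by rewrite cats0 -catA.
rewrite !expand -hsumZ; apply: eq_hsum => t1 ht1 _; rewrite -hsumZ.
by apply: eq_hsum => t2 ht2 _; exact: Fsym.
Qed.

Lemma homog_args_cat t1 t2 : homog_args (t1 ++ t2) =
  homog_args t1 && homog_args t2.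
Proof. exact: all_cat. Qed.

Lemma homog_args_perm t1 t2 : perm_eq t1 t2 -> homog_args t1 = homog_args t2.
Proof. by move=> t12; apply: perm_all. Qed.

Lemma iota_symmetric F G : multilinear_form F -> multilinear_form G ->
  graded_symmetric F -> graded_symmetric G -> graded_symmetric (iota_form F G).
Proof.
move=> F_ml G_ml F_sym G_sym; apply: graded_symmetric_on_homog;
  first exact: iota_multilinear.
move=> t1 t2 i j x y ht1 ht2 hx hy.
have vE u v : vec t1 ++ u.2 :: v.2 :: vec t2 = vec (t1 ++ u :: v :: t2).
  by rewrite map_cat.
rewrite (vE (i, x) (j, y)) (vE (j, y) (i, x)) !iota_formE_homog //
  ?homog_args_cat /= ?ht1 ?hx ?hy //.
apply: (@usum_swap _ _ _ deg (i, x) (j, y)) => *; rewrite !map_cat /=;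
  last first.
  exact: (G_sym (_ :: _)).
by rewrite (F_sym _ _ i j) // (multilinearZ G_ml [::]).
Qed.

Lemma has_degreeP a F :
  has_degree a F <-> forall t, homog_args t ->
    homog (sdeg deg t + a) (F (vec t)).
Proof.
split=> [hF t ht|hF d s ds].
  have := hF (map fst t) (vec t); rewrite big_map; apply.
  by elim: t ht => [//|p t IH] /= /andP[-> /IH].
have := hF (zip d s); rewrite /sdeg; move: ds;
  rewrite all2E => /andP[/eqP sd ds].
rewrite -(big_map fst xpredT id) -/(unzip1 _) unzip1_zip ?sd // -/(unzip2 _)
  unzip2_zip ?sd //.
exact.
Qed.

Lemma iota_degree (a b : int) F G : multilinear_form F -> multilinear_form G ->
  has_degree a F -> has_degree b G -> has_degree (a + b) (iota_form F G).
Proof.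
move=> F_ml G_ml /has_degreeP hF /has_degreeP hG; apply/has_degreeP => t ht.
rewrite iota_formE_homog //.
have usum_homog e t' (phi : seq T -> seq T -> E) :
    (forall l r, perm_eq (l ++ r) t' -> homog e (phi l r)) ->
      homog e (usum deg t' phi).
  elim: t' phi => [|p t' IH] phi hphi /=; first exact: hphi.
  apply: homogD; apply: IH => l r lr; first by apply: hphi;
    rewrite /= perm_cons.
  by apply/homogZ/hphi; rewrite -(cat1s p r) perm_catCA /= perm_cons.
apply: usum_homog => l r lr.
have /andP[hl hr] : homog_args l && homog_args r by
  rewrite -homog_args_cat (homog_args_perm lr).
have := hG ((sdeg deg l + a, F (vec l)) :: r).
rewrite /= hF // hr sdeg_cons -(sdeg_perm deg lr) sdeg_cat /= => /(_ isT).
by congr (homog _ _); ring.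
Qed.

Lemma iota_form_symmetric (a b : int) F G : symform a F -> symform b G ->
  symform (a + b) (iota_form F G).
Proof.
case=> F_ml F_sym F_deg [G_ml G_sym G_deg]; split.
- exact: iota_multilinear.
- exact: iota_symmetric.
- exact: iota_degree.
Qed.

Lemma multilinear_formD F G : multilinear_form F -> multilinear_form G ->
  multilinear_form (F + G).
Proof.
move=> F_ml G_ml s1 s2 c x y; rewrite !addrfctE F_ml G_ml scalerDr addrACA.
by [].
Qed.

Lemma multilinear_formZ a F : multilinear_form F -> multilinear_form (a *: F).
Proof.
by move=> F_ml s1 s2 c x y; rewrite !scalrfctE F_ml scalerDr !scalerA mulrC.
Qed.

Lemma multilinear_formN F : multilinear_form F -> multilinear_form (- F).
Proof.
by move=> F_ml; have := multilinear_formZ (-1) F_ml; rewrite scaleN1r.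
Qed.

Lemma multilinear_form0 : multilinear_form (0 : vform E).
Proof. by move=> *; rewrite scaler0 addr0. Qed.

Lemma symmetric_formD a F G : symform a F -> symform a G -> symform a (F + G).
Proof.
case=> F_ml F_sym F_deg [G_ml G_sym G_deg]; split;
  first exact: multilinear_formD.
- by move=> s1 s2 i j x y hx hy;
  rewrite !addrfctE (F_sym _ _ i j) // (G_sym _ _ i j) // scalerDr.
- by move=> d s ds; rewrite addrfctE homogD ?F_deg ?G_deg.
Qed.

Lemma symmetric_formZ a c F : symform a F -> symform a (c *: F).
Proof.
case=> F_ml F_sym F_deg; split; first exact: multilinear_formZ.
- by move=> s1 s2 i j x y hx hy;
  rewrite !scalrfctE (F_sym _ _ i j) // !scalerA mulrC.
- by move=> d s ds; rewrite scalrfctE homogZ ?F_deg.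
Qed.

Lemma symmetric_form0 a : symform a (0 : vform E).
Proof.
split; first exact: multilinear_form0.
- by move=> s1 s2 i j x y _ _; rewrite scaler0.
- by move=> d s _; exact: homog0.
Qed.

Lemma symmetric_form_sum a (I : Type) (r : seq I) (P : pred I) (F : I ->
  vform E) :
  (forall i, P i -> symform a (F i)) -> symform a (\sum_(i <- r | P i) F i).
Proof.
by move=> hF; apply: big_ind hF;
  [exact: symmetric_form0 | move=> *; exact: symmetric_formD].
Qed.

Lemma vcomp_multilinear m F : multilinear_form F ->
  multilinear_form (vcomp m F).
Proof.
move=> F_ml s1 s2 c x y; rewrite /vcomp !size_cat /=; case: ifP => _;
  first exact: F_ml.
by rewrite scaler0 addr0.
Qed.

Lemma vcomp_symmetric a m F : symform a F -> symform a (vcomp m F).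
Proof.
case=> F_ml F_sym F_deg; split; first exact: vcomp_multilinear.
- rewrite /vcomp; move=> s1 s2 i j x y hx hy; rewrite !size_cat /=;
  case: ifP => _; first exact: F_sym.
  by rewrite scaler0.
- by rewrite /vcomp => d s ds; case: ifP => _; [exact: F_deg | exact: homog0].
Qed.

Lemma iota_formDl F1 F2 G : multilinear_form F1 -> multilinear_form F2 ->
  multilinear_form G ->
  iota_form (F1 + F2) G = iota_form F1 G + iota_form F2 G.
Proof.
move=> F1_ml F2_ml G_ml; have F_ml := multilinear_formD F1_ml F2_ml.
apply: multilinear_ext => [||t ht];
  [exact: iota_multilinear| by apply: multilinear_formD;
  exact: iota_multilinear|].
rewrite [in RHS]addrfctE !iota_formE_homog // /iota_homog -usumD;
  apply: eq_usum => l r _.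
exact: (multilinearD G_ml [::]).
Qed.

Lemma iota_formDr F G1 G2 : multilinear_form F -> multilinear_form G1 ->
  multilinear_form G2 ->
  iota_form F (G1 + G2) = iota_form F G1 + iota_form F G2.
Proof.
move=> F_ml G1_ml G2_ml; have G_ml := multilinear_formD G1_ml G2_ml.
apply: multilinear_ext => [||t ht];
  [exact: iota_multilinear| by apply: multilinear_formD;
  exact: iota_multilinear|].
by rewrite [in RHS]addrfctE !iota_formE_homog // /iota_homog -usumD.
Qed.

Lemma iota_formZl c F G : multilinear_form F -> multilinear_form G ->
  iota_form (c *: F) G = c *: iota_form F G.
Proof.
move=> F_ml G_ml; have cF_ml := multilinear_formZ c F_ml.
apply: multilinear_ext => [||t ht];
  [exact: iota_multilinear| by apply: multilinear_formZ;
  exact: iota_multilinear|].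
rewrite [in RHS]scalrfctE !iota_formE_homog // /iota_homog -usumZ;
  apply: eq_usum => l r _.
exact: (multilinearZ G_ml [::]).
Qed.

Lemma iota_formZr c F G : multilinear_form F -> multilinear_form G ->
  iota_form F (c *: G) = c *: iota_form F G.
Proof.
move=> F_ml G_ml; have cG_ml := multilinear_formZ c G_ml.
apply: multilinear_ext => [||t ht];
  [exact: iota_multilinear| by apply: multilinear_formZ;
  exact: iota_multilinear|].
by rewrite [in RHS]scalrfctE !iota_formE_homog // /iota_homog -usumZ.
Qed.

(** * The pre-Lie identity *)

Lemma homog_args_split l r t : homog_args t -> perm_eq (l ++ r) t ->
  homog_args l /\ homog_args r.
Proof.
by move=> ht lr; apply/andP; rewrite -homog_args_cat (homog_args_perm lr).
Qed.

(** The part of the iterated insertion of F and G into H in which neither of F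
and G is nested in the other. *)
Definition disjoint_insertion a F G H t : E :=
  usum deg t (fun l r => usum deg r (fun u v =>
    sg ((sdeg deg l + a) * sdeg deg u) *: H (G (vec u) :: F (vec l) :: vec v))).

(** After F(l) has been put in front of the remaining arguments, G either takes
it in, which gives the insertion of iota_F G by coassociativity, or leaves
it, which gives the disjoint part with the sign of moving F(l) past the
arguments of G. *)
Lemma iota_nested a F G H t : symform a F -> multilinear_form G ->
  multilinear_form H ->
  homog_args t -> iota_form F (iota_form G H) (vec t) =
    iota_form (iota_form F G) H (vec t) + disjoint_insertion a F G H t.
Proof.
move=> [F_ml _ /has_degreeP F_deg] G_ml H_ml ht.
rewrite !iota_formE_homog //; [|exact: iota_multilinear..].
rewrite [RHS]addrC.
transitivity (usum deg t (fun l r =>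
   usum deg r (fun u v => H (G (F (vec l) :: vec u) :: vec v)) +
   usum deg r (fun u v => sg ((sdeg deg l + a) * sdeg deg u) *:
      H (G (vec u) :: F (vec l) :: vec v)))).
  apply: eq_usum => l r /(homog_args_split ht)[hl hr].
  by rewrite -[_ :: _]/(vec ((sdeg deg l + a, F (vec l)) :: r))
    iota_formE_homog //= F_deg.
rewrite usumD addrC; congr (_ + _); rewrite usum_assoc.
apply: eq_usum => c b /(homog_args_split ht)[hc _];
  rewrite iota_formE_homog // /iota_homog.
by rewrite (multilinear_usum H_ml).
Qed.

(** Exchange the argument blocks of F and G by cocommutativity and the values of
F and G by the symmetry of H; the signs cancel up to that of exchanging F
and G. *)
Lemma disjoint_insertionC (a b : int) F G H t :
  has_degree a F -> has_degree b G -> graded_symmetric H -> homog_args t ->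
  disjoint_insertion a F G H t = sg (a * b) *: disjoint_insertion b G F H t.
Proof.
move=> /has_degreeP F_deg /has_degreeP G_deg H_sym ht.
rewrite /disjoint_insertion usumCA -usumZ.
apply: eq_usum => l r /(homog_args_split ht)[hl hr]; rewrite -usumZ.
apply: eq_usum => u v /(homog_args_split hr)[hu hv].
rewrite (H_sym [::] _ _ _ _ _ (F_deg u hu) (G_deg l hl)) !scalerA -!sgD.
by congr (_ *: _); apply: (@sg_parity _ (- (a * b + b * sdeg deg u))); ring.
Qed.

(** The associator of insertion is the disjoint insertion, which is graded
symmetric in F and G. *)
Lemma iota_prelie (a b : int) F G H :
  symform a F -> symform b G -> multilinear_form H -> graded_symmetric H ->
  iota_form F (iota_form G H) - iota_form (iota_form F G) H =
  sg (a * b) *: (iota_form G (iota_form F H) - iota_form (iota_form G F) H).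
Proof.
move=> hF hG H_ml H_sym; have [F_ml _ F_deg] := hF; have [G_ml _ G_deg] := hG.
have mlB (P Q : vform E) : multilinear_form P -> multilinear_form Q ->
  multilinear_form (P - Q).
  by move=> hP hQ; apply: multilinear_formD => //; exact: multilinear_formN.
apply: multilinear_ext => [||t ht].
- by apply: mlB; do ! apply: iota_multilinear => //.
- by apply/multilinear_formZ/mlB; do ! apply: iota_multilinear => //.
rewrite [in LHS]addrfctE [in LHS]opprfctE [in RHS]scalrfctE [in RHS]addrfctE
  [in RHS]opprfctE.
rewrite (iota_nested hF) // (iota_nested hG) // addrAC subrr add0r addrAC subrr
  add0r.
exact: disjoint_insertionC.
Qed.

End Insertion.

Section Deformation.
Variables (K : numFieldType) (E : gradedLmodType K).
Local Notation T := (int * E)%type.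
Local Notation deg := (fun p : T => p.1).
Local Notation vec t := [seq p.2 | p <- t].
Implicit Types (F G H N mu : vform E) (x y : E) (s : seq E) (t l r : seq T).

Lemma iota_form0l G : multilinear_form G -> iota_form 0 G = 0.
Proof.
by move=> G_ml; have := iota_formZl 0 (@multilinear_form0 K E) G_ml;
  rewrite !scale0r.
Qed.

Lemma iota_form0r F : multilinear_form F -> iota_form F 0 = 0.
Proof.
by move=> F_ml; have := iota_formZr 0 F_ml (@multilinear_form0 K E);
  rewrite !scale0r.
Qed.

Lemma iota_formNl F G : multilinear_form F -> multilinear_form G ->
  iota_form (- F) G = - iota_form F G.
Proof.
by move=> F_ml G_ml; have := iota_formZl (-1) F_ml G_ml; rewrite !scaleN1r.
Qed.

Lemma vform_self_opp F : F = - F -> F = 0.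
Proof.
move=> FN; have : (2 : K) *: F = 0 by rewrite scaler_nat mulr2n {1}FN addNr.
by move/(congr1 ( *:%R (2^-1 : K)));
  rewrite scalerA mulVf ?pnatr_eq0 // scale1r scaler0.
Qed.

(** * Bracket, arity and degree *)

(** The Richardson-Nijenhuis bracket when one of the degrees is 0, so that the
sign is 1. *)
Definition bracket F G : vform E := iota_form F G - iota_form G F.

Lemma rn_bracket0 a F G : rn_bracket 0 a F G = bracket F G.
Proof. by rewrite /rn_bracket mul0r expr0z scale1r. Qed.

Lemma symmetric_formN a F : symform a F -> symform a (- F).
Proof. by move=> hF; have := symmetric_formZ (-1) hF; rewrite scaleN1r. Qed.

Lemma bracket_symmetric a F G : symform 0 F -> symform a G ->
  symform a (bracket F G).
Proof.
move=> hF hG; apply: symmetric_formD.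
  by have := iota_form_symmetric hF hG; rewrite add0r.
by apply: symmetric_formN; have := iota_form_symmetric hG hF; rewrite addr0.
Qed.

Lemma bracketDl F1 F2 G :
  multilinear_form F1 -> multilinear_form F2 -> multilinear_form G ->
  bracket (F1 + F2) G = bracket F1 G + bracket F2 G.
Proof.
by move=> *; rewrite /bracket iota_formDl // iota_formDr // opprD addrACA.
Qed.

Lemma bracketDr F G1 G2 :
  multilinear_form F -> multilinear_form G1 -> multilinear_form G2 ->
  bracket F (G1 + G2) = bracket F G1 + bracket F G2.
Proof.
by move=> *; rewrite /bracket iota_formDl // iota_formDr // opprD addrACA.
Qed.

Lemma bracketC F G : bracket F G = - bracket G F.
Proof. by rewrite /bracket opprB. Qed.

Lemma bracket_sumr (I : Type) (r : seq I) F (G : I -> vform E) :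
  multilinear_form F -> (forall i, multilinear_form (G i)) ->
  bracket F (\sum_(i <- r) G i) = \sum_(i <- r) bracket F (G i).
Proof.
move=> F_ml G_ml; elim: r => [|i r IH].
  by rewrite !big_nil /bracket iota_form0l // iota_form0r // subrr.
rewrite !big_cons bracketDr ?IH //.
by apply: big_ind => //;
  [exact: multilinear_form0 | move=> *; exact: multilinear_formD].
Qed.

Lemma bracket_suml (I : Type) (r : seq I) F (G : I -> vform E) :
  multilinear_form F -> (forall i, multilinear_form (G i)) ->
  bracket (\sum_(i <- r) G i) F = \sum_(i <- r) bracket (G i) F.
Proof.
move=> F_ml G_ml; rewrite bracketC bracket_sumr // -sumrN.
by apply: eq_bigr => i _; rewrite -bracketC.
Qed.

Definition vanishes_below p F := forall s, (size s < p)%N -> F s = 0.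

Lemma iota_vanishes_below p q F G : multilinear_form F -> multilinear_form G ->
  vanishes_below p F -> vanishes_below q G ->
  vanishes_below (p + q).-1 (iota_form F G).
Proof.
move=> F_ml G_ml F0 G0 s ss; have [I uI cov] := covers_exists s.
rewrite (iota_form_hsum F_ml G_ml uI cov) -(@hsum_eq0 _ _ I s (fun=> 0)) //.
apply: eq_hsum => t _ st; apply: usum0 => l r lr.
have [lp|pl] := ltnP (size l) p;
  first by rewrite F0 ?size_map // (multilinear0 G_ml [::]).
rewrite G0 //= size_map; move: ss; rewrite -st -(perm_size lr) size_cat.
by move: pl; rewrite /=; lia.
Qed.

Lemma bracket_vanishes_below p q F G : multilinear_form F ->
  multilinear_form G ->
  vanishes_below p F -> vanishes_below q G ->
  vanishes_below (p + q).-1 (bracket F G).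
Proof.
move=> F_ml G_ml F0 G0 s ss; rewrite /bracket addrfctE opprfctE.
rewrite (iota_vanishes_below F_ml G_ml F0 G0) //.
by rewrite (iota_vanishes_below G_ml F_ml G0 F0) ?subrr // addnC.
Qed.

(** On p or more nonzero homogeneous arguments, all of degree at most -1, the
value has degree at most a - p, below the lowest degree -n. *)
Lemma form_eq0_by_degree (n p : nat) (a : int) F : concentrated E n ->
  symform a F -> vanishes_below p F -> n%:Z + a < p%:Z -> F = 0.
Proof.
move=> En [F_ml _ /has_degreeP F_deg] F0 np.
apply: multilinear_ext => [||t ht] //; first exact: multilinear_form0.
have [tp|pt] := ltnP (size t) p; first by rewrite F0 // size_map.
have [t0|tN0] := boolP (0 \in vec t); first exact: multilinear_zero_arg.
have range i x : homog i x -> x != 0 -> - (n%:Z) <= i <= -1.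
  by move=> /eqP hx; apply: contraNT => /(En _ x) x0; rewrite -hx x0.
have sdeg_le : sdeg deg t <= - (size t)%:Z.
  elim: t {F_deg pt} ht tN0 => [|[i x] t IH] /=; first by rewrite /sdeg big_nil.
  rewrite inE negb_or eq_sym sdeg_cons => /andP[hx ht] /andP[x0 t0].
  have /andP[_ i1] := range _ _ hx x0; have tn := IH ht t0.
  by rewrite -addn1 PoszD opprD addrC lerD.
apply/eqP; apply: contraT => /(range _ _ (F_deg t ht)).
by move: np pt sdeg_le; lia.
Qed.

(** * Deforming a form of square zero *)

Section Square.
Variables (mu N : vform E).
Hypotheses (hmu : symform 1 mu) (hN : symform 0 N).
Hypothesis mu_square : iota_form mu mu = 0.
Let nu := bracket N mu.
Hypothesis N_nu : bracket N nu = 0.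

(** With nu = [N, mu], the pre-Lie identity for (mu, mu, N) gives iota_mu
iota_mu N = 0, since mu is odd, and that for (mu, N, mu) then gives iota_mu
nu + iota_nu mu = 0. Because N and nu commute, two more instances yield
iota_nu nu = iota_N iota_nu mu + iota_mu iota_N nu, and the instance for
(mu, N, nu) turns this into iota_nu nu = - iota_nu nu. *)
Lemma iota_square_deformed : iota_form (mu + nu) (mu + nu) = 0.
Proof.
have hnu : symform 1 nu by exact: bracket_symmetric.
have [mu_ml mu_sym _] := hmu; have [N_ml N_sym _] := hN;
  have [nu_ml nu_sym _] := hnu.
have Nnu : iota_form N nu = iota_form nu N by apply/eqP;
  rewrite -subr_eq0 -/(bracket _ _) N_nu.
have ml := iota_multilinear.
have nuE : iota_form N mu = nu + iota_form mu N by rewrite /nu /bracket subrK.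
have iota_nul G : multilinear_form G ->
    iota_form nu G = iota_form (iota_form N mu) G - iota_form (iota_form mu N)
      G.
  by move=> G_ml; rewrite nuE iota_formDl ?addrK //; exact: ml.
have iota_nur G : multilinear_form G ->
    iota_form G nu = iota_form G (iota_form N mu) - iota_form G
      (iota_form mu N).
  by move=> G_ml; rewrite nuE iota_formDr ?addrK //; exact: ml.
have mu_mu_N : iota_form mu (iota_form mu N) = 0.
  apply: vform_self_opp; have := iota_prelie hmu hmu N_ml N_sym.
  by rewrite mu_square iota_form0l // subr0 mulr1 expr1z scaleN1r.
have cross : iota_form mu nu + iota_form nu mu = 0.
  rewrite iota_nur // iota_nul // mu_mu_N subr0.
  have := iota_prelie hmu hN mu_ml mu_sym.
  rewrite mulr0 expr0z scale1r mu_square iota_form0r // sub0r addrCA => ->.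
  by rewrite addrN.
have nu_N_mu : iota_form nu (iota_form N mu) = iota_form N (iota_form nu mu).
  have := iota_prelie hnu hN mu_ml mu_sym.
  by rewrite mulr0 expr0z scale1r Nnu => /addIr.
have nu_mu_N : iota_form nu (iota_form mu N) = - iota_form mu (iota_form N nu).
  have := iota_prelie hnu hmu N_ml N_sym; rewrite mulr1 expr1z scaleN1r Nnu.
  have /eqP := cross; rewrite addr_eq0 => /eqP ->; rewrite iota_formNl //;
    last exact: ml.
  by rewrite opprK opprD => /addIr.
have nu_nu : iota_form nu nu = 0.
  have := iota_prelie hmu hN nu_ml nu_sym;
    rewrite mulr0 expr0z scale1r => mu_N_nu.
  apply: vform_self_opp; rewrite {1}iota_nur // nu_N_mu nu_mu_N opprK.
  have -> : iota_form mu (iota_form N nu) =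
    iota_form N (iota_form mu nu) - iota_form nu nu.
    rewrite iota_nul // opprB addrCA addrC
      -[LHS](subrK (iota_form (iota_form mu N) nu)).
    by rewrite mu_N_nu addrAC -addrA.
  rewrite addrA -iota_formDr //; [|exact: ml..].
  by rewrite addrC [X in iota_form N X]addrC cross iota_form0r // addr0.
rewrite iota_formDl //; last exact: multilinear_formD.
rewrite (iota_formDr mu_ml mu_ml nu_ml) (iota_formDr nu_ml mu_ml nu_ml).
by rewrite mu_square nu_nu add0r addr0.
Qed.

End Square.

(** * L-infinity structures as forms of square zero *)

(** On m arguments, a left block of size i and the inserted value leave m + 1 -
i arguments for the outer form. So each unshuffle occurs in exactly one
summand, except for those with empty left block, whose contribution is zero
as F has no component of arity 0. *)
Lemma Linfty_sumE F t (m : nat) : multilinear_form F -> F [::] = 0 ->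
  homog_args t ->
  (\sum_(1 <= i < m.+1) iota_form (vcomp i F) (vcomp (m.+1 - i)%N F)) (vec t) =
  if size t == m then iota_form F F (vec t) else 0.
Proof.
move=> F_ml F0 ht.
have term l r i : (1 <= i < m.+1)%N ->
  vcomp (m.+1 - i)%N F (vcomp i F (vec l) :: vec r) =
    if (size l == i) && (size l + size r == m)%N then F (F (vec l) :: vec r)
      else 0.
  move=> im; rewrite {2}/vcomp size_map; case: eqP => [li|_] /=; last first.
    by rewrite (multilinear0 (vcomp_multilinear _ F_ml) [::]).
  by rewrite /vcomp /= size_map; congr (if _ then _ else _); apply/eqP/eqP; lia.
rewrite fct_sumE iota_formE_homog // /iota_homog.
under eq_bigr => i _ do
  rewrite (iota_formE_homog (vcomp_multilinear _ F_ml)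
  (vcomp_multilinear _ F_ml) ht).
rewrite -usum_sum.
transitivity (usum deg t
  (fun l r => if size t == m then F (F (vec l) :: vec r) else 0)); last first.
  by case: ifP => // _; rewrite usum0.
apply: eq_usum => l r lr; rewrite -(perm_size lr) size_cat.
rewrite (eq_big_nat _ _ (term l r)).
case: eqP => [lrm|_]; last by rewrite big1 // => i _; rewrite andbF.
case: l lr lrm => [|p l] lr lrm.
  rewrite big_nat_cond big1 => [|i /andP[/andP[i1 _] _]]; last by case: i i1.
  by rewrite /= F0 (multilinear0 F_ml [::]).
rewrite (bigD1_seq (size (p :: l))) ?iota_uniq ?mem_index_iota //=; last first.
  by rewrite -lrm /= ltnS leq_addr.
rewrite eqxx big1 ?addr0 // => i /negPf il.
by rewrite eq_sym il.
Qed.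

Lemma Linfty_squareP F : symform 1 F -> F [::] = 0 ->
  Linfty_structure F <-> iota_form F F = 0.
Proof.
move=> hF F0; have F_ml : multilinear_form F by case: hF.
split=> [[_ _ sq]|sq].
  apply: multilinear_ext => [||t ht];
    [exact: iota_multilinear|exact: multilinear_form0|].
  have [t0|t_gt0] := posnP (size t).
    by rewrite iota_formE_homog // (size0nil t0) /iota_homog /= F0
      (multilinear0 F_ml [::]).
  by have := Linfty_sumE (size t) F_ml F0 ht; rewrite eqxx sq.
split=> // m m_gt0; apply: multilinear_ext => [||t ht]; last 2 first.
- exact: multilinear_form0.
- by rewrite Linfty_sumE // sq; case: ifP.
apply: (big_ind (@multilinear_form K E)) => [||i _];
  [exact: multilinear_form0|by move=> *; exact: multilinear_formD|].
by apply: iota_multilinear; exact: vcomp_multilinear.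
Qed.

(** * The Euler form *)

Local Arguments euler : simpl never.

Section Euler.

Lemma euler_homog i x : homog i x -> euler E [:: x] = (- i)%:~R *: x.
Proof.
move=> hx; rewrite /euler (fsbigE [:: i]) //.
  by rewrite big_mkcond big_seq1 in_setT (eqP hx).
by move=> j _; rewrite inE => ji; rewrite (homog_gpart_neq hx ji) scaler0.
Qed.

Lemma euler_neq1 s : size s != 1%N -> euler E s = 0.
Proof. by case: s => [|x []]. Qed.

Lemma euler_symmetric : symform 0 (euler E).
Proof.
split.
- move=> s1 s2 a x y.
  have [s0|sN0] := eqVneq (size s1 + size s2)%N 0%N; last first.
    by rewrite !euler_neq1 ?scaler0 ?addr0 // size_cat /= addnS.
  have [-> ->] : s1 = [::] /\ s2 = [::].
    by move: s0; case: (s1) => //; case: (s2).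
  have [I uI cov] := covers_exists [:: a *: x + y; x; y].
  have eulerE z : z \in [:: a *: x + y; x; y] ->
      euler E [:: z] = \sum_(i <- I) (- i)%:~R *: gpart i z.
    move=> zin; rewrite /euler (fsbigE I) //; first by apply: eq_bigl => i;
      rewrite in_setT.
    by move=> i _ iI; rewrite (cov z i zin iI) scaler0.
  rewrite /= !eulerE ?inE ?eqxx ?orbT // scaler_sumr -big_split /=.
  by apply: eq_bigr => i _; rewrite gpart_linear scalerDr !scalerA mulrC.
- by move=> s1 s2 i j x y _ _;
  rewrite !euler_neq1 ?scaler0 // size_cat /= !addnS.
- apply/has_degreeP => -[|[i x] [|p t]] /= ht;
  try by rewrite euler_neq1 ?homog0.
  have /andP[hx _] := ht;
    rewrite (euler_homog hx) addr0 sdeg_cons /sdeg big_nil addr0.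
  exact: homogZ.
Qed.

(** Summing an insertion of the Euler form after a prefix p keeps the induction
going: an entry x that goes to the right block is moved back in front of the
inserted value, into the prefix, by the symmetry of F, and this cancels the
sign of the unshuffle. *)
Lemma usum_euler a F p t : symform a F -> homog_args t ->
  usum deg t (fun l r => F (p ++ euler E (vec l) :: vec r)) =
  (- sdeg deg t)%:~R *: F (p ++ vec t).
Proof.
case=> F_ml F_sym _; elim: t p => [|[i x] t IH] p /=.
  by rewrite euler_neq1 // (multilinear0 F_ml) /sdeg big_nil oppr0 scale0r.
case/andP=> hx ht; rewrite usum_only_nil_left => [|q l r]; last first.
  by rewrite euler_neq1 // (multilinear0 F_ml).
rewrite /= (euler_homog hx) (multilinearZ F_ml) sdeg_cons opprD intrD scalerDl;
  congr (_ + _).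
rewrite -cat_rcons -IH //; apply: eq_usum => l r lr.
have hl : homog_args l by move: ht;
  rewrite -(homog_args_perm lr) homog_args_cat => /andP[].
have hel : homog (sdeg deg l + 0) (euler E (vec l)).
  by case: euler_symmetric => _ _ /has_degreeP; apply.
rewrite cat_rcons (F_sym _ _ _ _ _ _ hel hx) scalerA.
by rewrite addr0 -sgD (@sg_parity _ (i * sdeg deg l) _ 0) ?expr0z ?scale1r //=;
  ring.
Qed.

(** Inserting S into F multiplies by minus the total degree of the arguments,
inserting F into S by minus the degree of the value, and these differ by the
degree a of F. *)
Lemma bracket_euler (a : int) F : symform a F ->
  bracket (euler E) F = a%:~R *: F.
Proof.
move=> hF; have [F_ml _ /has_degreeP F_deg] := hF.
have [S_ml _ _] := euler_symmetric.
apply: multilinear_ext => [||t ht]; last first.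
- rewrite /bracket addrfctE opprfctE !iota_formE_homog //
  [in X in X - _]/iota_homog.
  rewrite (usum_euler [::] hF ht) /= /iota_homog usum_only_nil_right =>
    [|l x r]; last by rewrite euler_neq1.
  rewrite (euler_homog (F_deg t ht)) -scalerBl -intrB scalrfctE;
    congr (_%:~R *: _).
  by ring.
- exact: multilinear_formZ.
- by apply: multilinear_formD; [|apply: multilinear_formN];
  exact: iota_multilinear.
Qed.

End Euler.

End Deformation.

(** * The proposition *)

(** The components of mu of arity above n + 2 - k contribute to [N, mu] only in
arities at least n + 2, where forms of degree 1 vanish. *)
Lemma bracket_vcomp_sum (K : numFieldType) (E : gradedLmodType K) (n k : nat)
    (mu N : vform E) :
  concentrated E n -> symform 1 mu -> mu [::] = 0 -> symform 0 N ->
  vanishes_below k N -> (k <= n + 1)%N ->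
  bracket N mu = \sum_(1 <= m < (n + 2 - k).+1) bracket N (vcomp m mu).
Proof.
move=> En hmu mu0 hN N0 k_hi; have [mu_ml _ _] := hmu; have [N_ml _ _] := hN.
set M := (n + 2 - k)%N; pose tau := \sum_(1 <= m < M.+1) vcomp m mu.
have htau : symform 1 tau by apply: symmetric_form_sum => m _;
  exact: vcomp_symmetric.
have [tau_ml _ _] := htau.
have hdiff : symform 1 (mu - tau) by apply: symmetric_formD => //;
  exact: symmetric_formN.
have [diff_ml _ _] := hdiff.
rewrite -bracket_sumr => [|//|m]; last exact: vcomp_multilinear.
rewrite -/tau -[in LHS](subrK tau mu) bracketDr //.
suff -> : bracket N (mu - tau) = 0 by rewrite add0r.
have diff0 : vanishes_below M.+1 (mu - tau).
  move=> s sM; rewrite addrfctE opprfctE /tau fct_sumE.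
  have [/size0nil ->|s_gt0] := posnP (size s).
    rewrite mu0 big_nat_cond big1 ?subrr // => m /andP[/andP[m1 _] _].
    by rewrite /vcomp; case: m m1.
  rewrite (bigD1_seq (size s)) ?iota_uniq ?mem_index_iota ?s_gt0 //=.
  rewrite {1}/vcomp eqxx big1 ?addr0 ?subrr // => m ms.
  by rewrite /vcomp eq_sym (negPf ms).
apply: (form_eq0_by_degree En (bracket_symmetric hN hdiff)
  (bracket_vanishes_below N_ml diff_ml N0 diff0)).
by rewrite /M; lia.
Qed.

Theorem proposition2p5p4 (K : numFieldType) (E : gradedLmodType K) (n : nat)
    (mu : vform E) (r : nat) (k : 'I_r -> nat) (N : 'I_r -> vform E)
    (hmu : Lie_n_algebra n mu)
    (hN : forall i : 'I_r, symmetric_kform (k i) 0 (N i))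
    (hk_lo : forall i : 'I_r, (n + 3 <= 2 * k i)%N)
    (hk_mono : forall i j : 'I_r, (i <= j)%N -> (k i <= k j)%N)
    (hk_hi : forall i : 'I_r, (k i <= n + 1)%N) :
  [/\ nijenhuis_form mu (euler E + \sum_(i < r) N i)
                        (euler E + 2 *: (\sum_(i < r) N i)),
      Lie_n_algebra n (rn_bracket 0 1 (euler E + \sum_(i < r) N i) mu) &
      rn_bracket 0 1 (euler E + \sum_(i < r) N i) mu =
        mu + \sum_(i < r) \sum_(1 <= m < (n + 2 - k i).+1)
               rn_bracket 0 1 (N i) (vcomp m mu)].
Proof.
have [En [hmu1 mu0 mu_eq]] := hmu; have [mu_ml _ _] := hmu1.
have mu_sq : iota_form mu mu = 0 by apply/(Linfty_squareP hmu1 mu0).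
have hNi i : symform 0 (N i) by case: (hN i).
have Ni_ml i : multilinear_form (N i) by case: (hNi i).
have Ni0 i : vanishes_below (k i) (N i).
  by move=> s sk; have [_ ->//] := hN i; move: sk;
    rewrite ltn_neqAle => /andP[].
set M := \sum_(i < r) N i.
have hM : symform 0 M by apply: symmetric_form_sum.
have [M_ml _ _] := hM.
have hS := euler_symmetric E; have [S_ml _ _] := hS.
(* The least p with 2 p >= n + 3; it bounds all the k_i from below. *)
pose p := ((n + 4)./2)%N.
have p2 : (n + 3 <= 2 * p)%N by rewrite /p; lia.
have M0 : vanishes_below p M.
  move=> s sp; rewrite /M fct_sumE big1 // => i _; apply: Ni0.
  by apply: leq_trans sp _; have := hk_lo i; rewrite /p; lia.
have mu_below : vanishes_below 1 mu by move=> [|//] _.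
pose nu := bracket M mu.
have hnu : symform 1 nu by exact: bracket_symmetric.
have [nu_ml _ _] := hnu.
have nu0 : vanishes_below p nu.
  by have := bracket_vanishes_below M_ml mu_ml M0 mu_below; rewrite addn1.
have M_nu : bracket M nu = 0.
  apply: (form_eq0_by_degree En (bracket_symmetric hM hnu)
    (bracket_vanishes_below M_ml nu_ml M0 nu0)).
  by lia.
have S_br X : symform 1 X -> bracket (euler E) X = X.
  by move=> hX; rewrite (bracket_euler hX) scale1r.
have S_M : bracket (euler E) M = 0 by rewrite (bracket_euler hM) scale0r.
have br_self X : bracket X X = 0 by rewrite /bracket subrr.
have hSM := symmetric_formD hS hM; have [SM_ml _ _] := hSM.
have h2M := symmetric_formZ 2 hM; have [M2_ml _ _] := h2M.
have SM_mu : bracket (euler E + M) mu = mu + nu by rewrite bracketDl // S_br.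
have mu_nu_ml := multilinear_formD mu_ml nu_ml.
rewrite !rn_bracket0 SM_mu; split.
- split; [exact: hSM|exact: symmetric_formD| |]; rewrite !rn_bracket0.
    rewrite SM_mu bracketDr // SM_mu !bracketDl // !S_br // M_nu addr0.
    by rewrite scaler_nat mulr2n bracketDl // -addrA.
  rewrite scaler_nat mulr2n addrA bracketDr // br_self add0r bracketDl //.
  by rewrite S_M br_self addr0.
- split=> //; apply/Linfty_squareP.
  + exact: symmetric_formD.
  + by rewrite addrfctE mu0 add0r nu0 //; move: p2; case: (p) => //;
    rewrite muln0 addn3.
  + exact: iota_square_deformed.
congr (_ + _); rewrite /nu /M bracket_suml //; apply: eq_bigr => i _.
rewrite (bracket_vcomp_sum En hmu1 mu0 (hNi i) (Ni0 i)) //.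
by apply: eq_bigr => m _; rewrite rn_bracket0.
Qed.
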